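(* For $n \geq 1$ let $S_n = \{a \in \mathbb{N} : a = x_1^2 + \cdots + x_n^2 \text{ for some integers } x_i \geq 0\}$, and let $R(S_n) = \{a/a' : a,a' \in S_n\}$. (a) $R(S_1)$ is not dense in $\mathbb{Q}_p$ for any prime $p$. (b) For a prime $p$, $R(S_2)$ is dense in $\mathbb{Q}_p$ if and only if $p \equiv 1 \pmod 4$. (c) For every $n \geq 3$, $R(S_n)$ is dense in $\mathbb{Q}_p$ for every prime $p$.
   Context: $\mathbb{N} = \{1,2,\ldots\}$; $\mathbb{Q}_p$ denotes the field of $p$-adic numbers with the $p$-adic metric. *)

(* Defs.v *)
From HB Require Import structures.
From mathcomp Require Import all_boot all_order all_algebra.
From mathcomp Require Import generic_quotient ring_quotient.
From mathcomp Require Import all_classical topology.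
Set Implicit Arguments.
Unset Strict Implicit.
Unset Printing Implicit Defensive.
Import Order.TTheory GRing.Theory Num.Theory.
Local Open Scope classical_set_scope.
Local Open Scope ring_scope.

Section PadicAbs.
Variable p : nat.

Definition padic_val (x : rat) : int :=
  (logn p `|numq x|)%:Z - (logn p `|denq x|)%:Z.

(* When p is not prime, logn p is 0 and this is the trivial absolute value;
   so everything below is total in p. *)
Definition padic_abs (x : rat) : rat :=
  if x == 0 then 0 else p%:R ^ (- padic_val x).

Lemma padic_val_div (a b : int) : a != 0 -> b != 0 ->
  padic_val (a%:~R / b%:~R) = (logn p `|a|)%:Z - (logn p `|b|)%:Z.
Proof.
move=> a0 b0; set x := _ / _.
have x0 : x != 0 by rewrite mulf_neq0 ?invr_eq0 ?intr_eq0.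
have E : numq x * b = a * denq x.
  apply: (@intr_inj rat); rewrite !rmorphM /= numqE mulrAC.
  by rewrite divfK ?intr_eq0.
have := congr1 (fun z : int => logn p `|z|) E; rewrite !abszM.
rewrite !lognM ?absz_gt0 ?denq_eq0 ?numq_eq0 // => L.
rewrite /padic_val; apply/eqP; rewrite subr_eq addrAC eq_sym subr_eq.
by rewrite -!PoszD -L.
Qed.

Lemma padic_valM x y : x != 0 -> y != 0 ->
  padic_val (x * y) = padic_val x + padic_val y.
Proof.
move=> x0 y0; rewrite -[x in LHS]divq_num_den -[y in LHS]divq_num_den.
rewrite mulf_div -!rmorphM /= padic_val_div ?mulf_neq0 ?denq_eq0 ?numq_eq0 //.
rewrite !abszM !lognM ?absz_gt0 ?denq_eq0 ?numq_eq0 // !PoszD /padic_val.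
by rewrite opprD addrACA.
Qed.

Lemma logn_addz (a b : int) : a + b != 0 -> a != 0 -> b != 0 ->
  (minn (logn p `|a|) (logn p `|b|) <= logn p `|(a + b)%R|)%N.
Proof.
move=> ab0 a0 b0; case: (boolP (prime p)) => [pp|np]; last first.
  by rewrite /logn (negbTE np).
rewrite -pfactor_dvdn ?absz_gt0 //.
have dv (c : int) k : c != 0 -> (k <= logn p `|c|)%N -> ((p ^ k)%N%:Z %| c)%Z.
  by move=> c0; rewrite dvdzE absz_nat pfactor_dvdn ?absz_gt0.
have -> : forall d c, (d %| absz c)%N = (d%:Z %| c)%Z by move=> d c; rewrite dvdzE.
by rewrite rpredD // dv ?geq_minl ?geq_minr.
Qed.

Lemma padic_val_add x y : x != 0 -> y != 0 -> x + y != 0 ->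
  Num.min (padic_val x) (padic_val y) <= padic_val (x + y).
Proof.
move=> x0 y0 xy0.
pose d := denq x * denq y; pose a := numq x * denq y; pose b := numq y * denq x.
have d0 : d != 0 by rewrite mulf_neq0 ?denq_eq0.
have dq : d%:~R != 0 :> rat by rewrite intr_eq0.
have xE : x = a%:~R / d%:~R.
  by apply: (mulIf dq); rewrite divfK // /a /d !rmorphM /= numqE mulrA.
have yE : y = b%:~R / d%:~R.
  by apply: (mulIf dq); rewrite divfK // /b /d !rmorphM /= numqE mulrAC mulrA.
have a0 : a != 0 by rewrite mulf_neq0 ?numq_eq0 ?denq_eq0.
have b0 : b != 0 by rewrite mulf_neq0 ?numq_eq0 ?denq_eq0.
have E : x + y = (a + b)%:~R / d%:~R by rewrite xE yE rmorphD mulrDl.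
have ab0 : a + b != 0.
  by apply: contraNneq xy0 => ab; rewrite E ab mul0r.
rewrite E xE yE !padic_val_div //.
have := logn_addz ab0 a0 b0; rewrite geq_min => /orP[] h; rewrite ge_min.
  by rewrite lerD2r lez_nat h.
by rewrite !lerD2r !lez_nat h orbT.
Qed.

Lemma padic_abs0 : padic_abs 0 = 0. Proof. by rewrite /padic_abs eqxx. Qed.

Lemma padic_abs1 : padic_abs 1 = 1.
Proof. by rewrite /padic_abs oner_eq0 /padic_val (numq_int 1) (denq_int 1) subrr oppr0. Qed.

Let padic_basis (x : rat) : 0 < (p%:R : rat) \/ padic_val x = 0.
Proof.
case: (posnP p) => [p0|pp]; last by left; rewrite ltr0n.
by right; rewrite /padic_val p0.
Qed.

Lemma padic_abs_gt0 x : x != 0 -> 0 < padic_abs x.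
Proof.
move=> x0; rewrite /padic_abs (negbTE x0).
by case: (padic_basis x) => [pp|->]; rewrite ?oppr0 ?expr0z // exprz_gt0.
Qed.

Lemma padic_abs_ge0 x : 0 <= padic_abs x.
Proof.
have [->|x0] := eqVneq x 0; first by rewrite padic_abs0.
exact/ltW/padic_abs_gt0.
Qed.

Lemma padic_abs_eq0 x : (padic_abs x == 0) = (x == 0).
Proof.
have [->|x0] := eqVneq x 0; first by rewrite padic_abs0 eqxx.
by rewrite gt_eqF // padic_abs_gt0.
Qed.

Lemma padic_absM x y : padic_abs (x * y) = padic_abs x * padic_abs y.
Proof.
have [->|x0] := eqVneq x 0; first by rewrite mul0r padic_abs0 mul0r.
have [->|y0] := eqVneq y 0; first by rewrite mulr0 padic_abs0 mulr0.
rewrite /padic_abs mulf_eq0 (negbTE x0) (negbTE y0) /= padic_valM // opprD.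
case: (padic_basis x) => [pp|->]; first by rewrite expfzDr ?gt_eqF.
by rewrite oppr0 add0r mul1r.
Qed.

Lemma padic_absN x : padic_abs (- x) = padic_abs x.
Proof. by rewrite /padic_abs oppr_eq0 /padic_val numqN denqN abszN. Qed.

Lemma padic_abs_add x y :
  padic_abs (x + y) <= Num.max (padic_abs x) (padic_abs y).
Proof.
have [->|x0] := eqVneq x 0; first by rewrite add0r le_max lexx orbT.
have [->|y0] := eqVneq y 0; first by rewrite addr0 le_max lexx.
have [->|xy0] := eqVneq (x + y) 0.
  by rewrite padic_abs0 le_max padic_abs_ge0.
have := padic_val_add x0 y0 xy0.
rewrite /padic_abs (negbTE x0) (negbTE y0) (negbTE xy0) ge_min le_max.
case: (posnP p) => [p0 _|pp]; last first.
  have p1 : 1 <= (p%:R : rat) by rewrite ler1n.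
  by case/orP=> h; apply/orP; [left|right]; apply: (ler_weXz2l p1); rewrite lerN2.
have v0 z : padic_val z = 0 by rewrite /padic_val p0.
by rewrite !v0 lexx.
Qed.

Lemma padic_absD x y : padic_abs (x + y) <= padic_abs x + padic_abs y.
Proof.
apply: le_trans (padic_abs_add x y) _.
by rewrite ge_max lerDl lerDr !padic_abs_ge0.
Qed.

Lemma padic_absC x y : padic_abs (x - y) = padic_abs (y - x).
Proof. by rewrite -opprB padic_absN. Qed.

Lemma padic_absV x : padic_abs x^-1 = (padic_abs x)^-1.
Proof.
have [->|x0] := eqVneq x 0; first by rewrite !(invr0, padic_abs0).
have ax : padic_abs x != 0 by rewrite padic_abs_eq0.
by apply: (mulfI ax); rewrite -padic_absM !divff // padic_abs1.
Qed.

(* |x| > |x - y| forces |x| = |y| *)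
Lemma padic_abs_isosceles x y :
  padic_abs (x - y) < padic_abs x -> padic_abs y = padic_abs x.
Proof.
move=> h; apply/eqP; rewrite eq_le; apply/andP; split.
  have := padic_abs_add x (- (x - y)); rewrite opprB subrKC => /le_trans; apply.
  by rewrite ge_max lexx padic_absC (ltW h).
have := padic_abs_add (x - y) y; rewrite subrK le_max.
by rewrite leNgt h /=.
Qed.

End PadicAbs.

Section CauchySequences.
Variable p : nat.
Implicit Types (u v : nat -> rat) (e : rat).

Definition padic_cauchy u : Prop := forall e, 0 < e ->
  exists N, forall m n, (N <= m)%N -> (N <= n)%N -> padic_abs p (u m - u n) < e.

Definition padic_null u : Prop := forall e, 0 < e ->
  exists N, forall n, (N <= n)%N -> padic_abs p (u n) < e.

Lemma padic_cauchy_bounded u : padic_cauchy u ->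
  exists2 M : rat, 0 < M & forall n, padic_abs p (u n) <= M.
Proof.
move=> /(_ 1 ltr01)[N hN].
exists (1 + padic_abs p (u N) + \sum_(i < N) padic_abs p (u i)) => [|n].
  by rewrite ltr_wpDr ?sumr_ge0 ?ltr_wpDr ?padic_abs_ge0 // => *; exact: padic_abs_ge0.
case: (leqP N n) => [Nn|nN].
  rewrite ler_wpDr ?sumr_ge0 // => [*|]; first exact: padic_abs_ge0.
  rewrite -[u n](subrK (u N)) (le_trans (padic_absD _ _ _)) // lerD2r.
  exact/ltW/hN.
rewrite (bigD1 (Ordinal nN)) //= ler_wpDl ?addr_ge0 ?padic_abs_ge0 //.
by rewrite lerDl sumr_ge0 // => *; exact: padic_abs_ge0.
Qed.

Lemma padic_cauchyB u v : padic_cauchy u -> padic_cauchy v -> padic_cauchy (u - v).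
Proof.
move=> cu cv e e0; have [N hN] := cu e e0; have [M hM] := cv e e0.
exists (maxn N M) => m n; rewrite !geq_max => /andP[Nm Mm] /andP[Nn Mn].
have -> : (u - v) m - (u - v) n = (u m - u n) - (v m - v n).
  rewrite /= -!addrA; congr (_ + _).
  by rewrite !opprB addrCA [RHS]addrCA; congr (_ + _); exact: addrC.
rewrite (le_lt_trans (padic_abs_add _ _ _)) // gt_max padic_absN.
by rewrite hN ?hM.
Qed.

Lemma padic_nullD u v : padic_null u -> padic_null v -> padic_null (u + v).
Proof.
move=> cu cv e e0; have [N hN] := cu e e0; have [M hM] := cv e e0.
exists (maxn N M) => m; rewrite !geq_max => /andP[Nm Mm].
rewrite (le_lt_trans (padic_abs_add _ _ _)) // gt_max.
by rewrite hN ?hM.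
Qed.

Lemma padic_nullM u v : padic_cauchy u -> padic_null v -> padic_null (u * v).
Proof.
move=> /padic_cauchy_bounded[M M0 hM] nv e e0.
have [N hN] := nv (e / M) (divr_gt0 e0 M0).
exists N => n Nn; rewrite padic_absM (@le_lt_trans _ _ (M * padic_abs p (v n))) //.
  by rewrite ler_wpM2r ?padic_abs_ge0.
by rewrite mulrC -ltr_pdivlMr // hN.
Qed.

Lemma padic_cauchyM u v : padic_cauchy u -> padic_cauchy v -> padic_cauchy (u * v).
Proof.
move=> cu cv e e0.
have [M M0 hM] := padic_cauchy_bounded cu.
have [K K0 hK] := padic_cauchy_bounded cv.
have [N1 hN1] := cu _ (divr_gt0 e0 K0).
have [N2 hN2] := cv _ (divr_gt0 e0 M0).
exists (maxn N1 N2) => m n; rewrite !geq_max => /andP[Nm Mm] /andP[Nn Mn].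
have -> : (u * v) m - (u * v) n = u m * (v m - v n) + (u m - u n) * v n.
  by rewrite mulrBr mulrBl addrA subrK.
rewrite (le_lt_trans (padic_abs_add _ _ _)) // gt_max !padic_absM.
apply/andP; split.
  rewrite (@le_lt_trans _ _ (M * padic_abs p (v m - v n))) //.
    by rewrite ler_wpM2r ?padic_abs_ge0.
  by rewrite mulrC -ltr_pdivlMr // hN2.
rewrite (@le_lt_trans _ _ (padic_abs p (u m - u n) * K)) //.
  by rewrite ler_wpM2l ?padic_abs_ge0.
by rewrite -ltr_pdivlMr // hN1.
Qed.

Lemma padic_cauchy_cst (q : rat) : padic_cauchy (fun=> q).
Proof. by move=> e e0; exists 0%N => m n _ _; rewrite subrr padic_abs0. Qed.

Lemma padic_nullPn u : padic_cauchy u -> ~ padic_null u ->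
  exists2 c : rat, 0 < c & exists N, forall n, (N <= n)%N -> padic_abs p (u n) = c.
Proof.
move=> cu /existsNP[e /not_implyP[e0 /forallNP nu]].
have [N hN] := cu e e0.
have /existsNP[n /not_implyP[Nn /negP]] := nu N; rewrite -leNgt => en.
exists (padic_abs p (u n)); first exact: lt_le_trans en.
exists N => m Nm; apply: padic_abs_isosceles.
by apply: lt_le_trans en; exact: hN.
Qed.

Definition cauchy_pred : {pred nat -> rat} := [pred u | `[< padic_cauchy u >]].

Lemma cauchy_subring : subring_closed cauchy_pred.
Proof.
split=> [|u v /asboolP cu /asboolP cv|u v /asboolP cu /asboolP cv]; apply/asboolP.
- exact: padic_cauchy_cst.
- exact: padic_cauchyB.
- exact: padic_cauchyM.
Qed.

HB.instance Definition _ :=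
  GRing.isSubringClosed.Build (nat -> rat) cauchy_pred cauchy_subring.

Record cauchy_seq := CauchySeq {
  cauchy_val :> nat -> rat; cauchy_valP : cauchy_val \in cauchy_pred }.

HB.instance Definition _ := [isSub for cauchy_val].
HB.instance Definition _ := [Choice of cauchy_seq by <:].
HB.instance Definition _ := [SubChoice_isSubComNzRing of cauchy_seq by <:].

Lemma cauchy_seqP (u : cauchy_seq) : padic_cauchy u.
Proof. exact/asboolP/cauchy_valP. Qed.

Definition null_ideal : {pred cauchy_seq} := [pred u | `[< padic_null (cauchy_val u) >]].

Lemma null_idealP : idealr_closed null_ideal.
Proof.
split.
- by apply/asboolP => e e0; exists 0%N => n _; rewrite /= padic_abs0.
- apply/negP => /asboolP /(_ 1 ltr01)[N /(_ N (leqnn N))].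
  by rewrite /= padic_abs1 ltxx.
- move=> a u v /asboolP nu /asboolP nv; apply/asboolP.
  exact: padic_nullD (padic_nullM (cauchy_seqP a) nu) nv.
Qed.

HB.instance Definition _ := isIdealr.Build cauchy_seq null_ideal null_idealP.

End CauchySequences.

(* Q_p as the ring of p-adic Cauchy sequences of rationals modulo the ideal of
   null sequences *)
Definition Qp (p : nat) := {ideal_quot (@null_ideal p)}.

HB.instance Definition _ p := GRing.ComNzRing.on (Qp p).

Section PadicNumbers.
Variable p : nat.
Implicit Types (u v : cauchy_seq p) (x y z : Qp p).
Local Open Scope quotient_scope.

Definition Qp_of u : Qp p := \pi_({ideal_quot (@null_ideal p)}) u.

Definition Qp_repr x : cauchy_seq p :=
  repr (x : {ideal_quot (@null_ideal p)}).

Lemma Qp_reprK : cancel Qp_repr Qp_of.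
Proof. by move=> x; exact: reprK. Qed.

Lemma Qp_ofP u v : Qp_of u = Qp_of v <-> padic_null p (u - v).
Proof.
split=> [/eqP|/asboolP h].
  by rewrite -Quotient.idealrBE => /asboolP.
by apply/eqP; rewrite -Quotient.idealrBE; exact: h.
Qed.

Lemma Qp_ofD u v : Qp_of (u + v) = Qp_of u + Qp_of v.
Proof. exact: rmorphD. Qed.

Lemma Qp_ofN u : Qp_of (- u) = - Qp_of u.
Proof. exact: rmorphN. Qed.

Lemma Qp_ofB u v : Qp_of (u - v) = Qp_of u - Qp_of v.
Proof. exact: rmorphB. Qed.

Lemma Qp_ofM u v : Qp_of (u * v) = Qp_of u * Qp_of v.
Proof. exact: rmorphM. Qed.

Lemma Qp_of1 : Qp_of 1 = 1. Proof. exact: rmorph1. Qed.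

Lemma Qp_of0 : Qp_of 0 = 0. Proof. exact: rmorph0. Qed.

Lemma Qp_of_eq0 u : Qp_of u = 0 <-> padic_null p u.
Proof. by rewrite -Qp_of0 Qp_ofP subr0. Qed.

Lemma Qp_of_neq0 u : Qp_of u != 0 ->
  exists2 c : rat, 0 < c & exists N, forall n, (N <= n)%N -> padic_abs p (u n) = c.
Proof.
by move=> /eqP u0; apply: padic_nullPn (cauchy_seqP u) _ => /Qp_of_eq0.
Qed.

Lemma Qp_inv_ex x : x != 0 -> exists y, y * x = 1.
Proof.
rewrite -(Qp_reprK x); set u := Qp_repr x => /Qp_of_neq0[c c0 [N hN]].
have u0 n : (N <= n)%N -> u n != 0.
  by move=> Nn; rewrite -(padic_abs_eq0 p) hN // gt_eqF.
have cv : padic_cauchy p (fun n => (u n)^-1).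
  move=> e e0; have [M hM] := cauchy_seqP u (mulr_gt0 e0 (mulr_gt0 c0 c0)).
  exists (maxn N M) => m n; rewrite !geq_max => /andP[Nm Mm] /andP[Nn Mn].
  have -> : (u m)^-1 - (u n)^-1 = (u n - u m) * ((u m)^-1 * (u n)^-1).
    by rewrite mulrBl mulrCA divff ?u0 // mulr1 mulrA divff ?u0 // mul1r.
  by rewrite !padic_absM !padic_absV !hN // -invfM ltr_pdivrMr ?mulr_gt0 // hM.
have vc : (fun n => (u n)^-1) \in cauchy_pred p by exact/asboolP.
exists (Qp_of (CauchySeq vc)); rewrite -Qp_ofM -Qp_of1.
apply/Qp_ofP => e e0; exists N => n Nn /=.
have -> : (cauchy_val (CauchySeq vc * u) - cauchy_val (1 : cauchy_seq p)) n =
  (u n)^-1 * u n - 1 by [].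
by rewrite mulVf ?subrr ?padic_abs0 ?u0.
Qed.

Definition Qp_inv x : Qp p := xget 0 [set y | y * x = 1].

Lemma Qp_mulVf x : x != 0 -> Qp_inv x * x = 1.
Proof. by move=> /Qp_inv_ex; exact: xgetPex. Qed.

Lemma Qp_inv0 : Qp_inv 0 = 0.
Proof.
rewrite /Qp_inv; case: xgetP => // y _ /=; rewrite mulr0 => /esym/eqP.
by rewrite oner_eq0.
Qed.

HB.instance Definition _ := GRing.ComNzRing_isField.Build (Qp p) Qp_mulVf Qp_inv0.

Definition abs_lim (u : nat -> rat) (c : rat) : Prop := forall e, 0 < e ->
  exists N, forall n, (N <= n)%N -> `|padic_abs p (u n) - c| < e.

(* |x|_p is the limit of |u_n|_p for any Cauchy sequence u representing x
   (Qp_abs_lim); the values of |.|_p on Q_p are those on Q, hence rational. *)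
Definition Qp_abs x : rat := xget 0 [set c | abs_lim (Qp_repr x) c].

Lemma abs_lim_ex u : exists c, abs_lim u c.
Proof.
have [/asboolP nu|/asboolP nu] := boolP `[< padic_null p u >].
  exists 0 => e e0; have [N hN] := nu e e0; exists N => n Nn.
  by rewrite subr0 ger0_norm ?padic_abs_ge0 // hN.
have [c _ [N hN]] := padic_nullPn (cauchy_seqP u) nu.
by exists c => e e0; exists N => n Nn; rewrite hN // subrr normr0.
Qed.

Lemma abs_lim_unique (u : nat -> rat) c d : abs_lim u c -> abs_lim u d -> c = d.
Proof.
move=> uc ud; apply/eqP/negPn/negP; rewrite -subr_eq0 -normr_gt0 => cd.
have cd2 : 0 < `|c - d| / 2 by rewrite divr_gt0.
have [N hN] := uc _ cd2; have [M hM] := ud _ cd2.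
have := ltrD (hN _ (leq_maxl N M)) (hM _ (leq_maxr N M)).
rewrite -splitr distrC => /(le_lt_trans (ler_normD _ _)).
by rewrite addrA subrK ltxx.
Qed.

Lemma padic_abs_dist a b : `|padic_abs p a - padic_abs p b| <= padic_abs p (a - b).
Proof.
rewrite ler_norml; apply/andP; split.
  rewrite lerNl opprB lerBlDr padic_absC (le_trans _ (padic_absD _ _ _)) //.
  by rewrite subrK.
by rewrite lerBlDr (le_trans _ (padic_absD _ _ _)) // subrK.
Qed.

Lemma abs_lim_null (u v : nat -> rat) c :
  padic_null p (u - v) -> abs_lim u c -> abs_lim v c.
Proof.
move=> nuv uc e e0; have e2 : 0 < e / 2 by rewrite divr_gt0.
have [N hN] := uc _ e2; have [M hM] := nuv _ e2.
exists (maxn N M) => n; rewrite !geq_max => /andP[Nn Mn].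
rewrite -(subrK (padic_abs p (u n)) (padic_abs p (v n))) -addrA.
rewrite (le_lt_trans (ler_normD _ _)) // (splitr e) ltrD ?hN //.
by rewrite (le_lt_trans (padic_abs_dist _ _)) // padic_absC hM.
Qed.

Lemma Qp_abs_lim u : abs_lim u (Qp_abs (Qp_of u)).
Proof.
rewrite /Qp_abs; set v := Qp_repr _.
have vc : abs_lim v (xget 0 [set c | abs_lim v c]).
  by apply: (@xgetPex _ _ [set c | abs_lim v c]); exact: abs_lim_ex.
by apply: abs_lim_null vc; apply/Qp_ofP; rewrite Qp_reprK.
Qed.

Lemma Qp_absE u c : abs_lim u c -> Qp_abs (Qp_of u) = c.
Proof. exact/abs_lim_unique/Qp_abs_lim. Qed.

Lemma Qp_abs_le u c : (exists N, forall n, (N <= n)%N -> padic_abs p (u n) <= c) ->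
  Qp_abs (Qp_of u) <= c.
Proof.
move=> [N hN]; apply/ler_addgt0Pl => e e0.
have [M hM] := Qp_abs_lim u e0.
have := hM _ (leq_maxr N M); have := hN _ (leq_maxl N M).
rewrite distrC => h1 /(le_lt_trans (ler_norm _)); rewrite ltrBlDr => /ltW/le_trans.
by apply; rewrite lerD2l.
Qed.

Lemma Qp_abs_lt u e : Qp_abs (Qp_of u) < e ->
  exists N, forall n, (N <= n)%N -> padic_abs p (u n) < e.
Proof.
rewrite -subr_gt0 => ue; have [N hN] := Qp_abs_lim u ue.
exists N => n /hN /(le_lt_trans (ler_norm _)).
by rewrite ltrD2r.
Qed.

Lemma Qp_abs_stable u : Qp_of u != 0 ->
  exists N, forall n, (N <= n)%N -> padic_abs p (u n) = Qp_abs (Qp_of u).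
Proof.
move=> /Qp_of_neq0[c c0 [N hN]]; exists N => n Nn; rewrite hN //.
apply/esym/Qp_absE => e e0; exists N => m Nm.
by rewrite hN // subrr normr0.
Qed.

Lemma Qp_abs_ge0 x : 0 <= Qp_abs x.
Proof.
rewrite -(Qp_reprK x) leNgt; apply/negP => /Qp_abs_lt[N /(_ N (leqnn N))].
by rewrite ltNge padic_abs_ge0.
Qed.

Lemma Qp_abs0 : Qp_abs 0 = 0.
Proof.
rewrite -Qp_of0; apply: Qp_absE => e e0; exists 0%N => n _.
by rewrite padic_abs0 subrr normr0.
Qed.

Lemma Qp_abs_eq0 x : (Qp_abs x == 0) = (x == 0).
Proof.
apply/eqP/eqP => [|->]; last exact: Qp_abs0.
rewrite -(Qp_reprK x) => ux; apply/Qp_of_eq0 => e e0.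
by apply: Qp_abs_lt; rewrite ux.
Qed.

Lemma Qp_absM x y : Qp_abs (x * y) = Qp_abs x * Qp_abs y.
Proof.
have [->|] := eqVneq x 0; first by rewrite mul0r Qp_abs0 mul0r.
have [->|] := eqVneq y 0; first by rewrite mulr0 Qp_abs0 mulr0.
rewrite -(Qp_reprK x) -(Qp_reprK y) => /Qp_abs_stable[N hN] /Qp_abs_stable[M hM].
rewrite -Qp_ofM; apply: Qp_absE => e e0; exists (maxn N M) => n.
rewrite geq_max => /andP[Nn Mn].
by rewrite [X in padic_abs p X]/= padic_absM hN // hM // subrr normr0.
Qed.

Lemma Qp_absN x : Qp_abs (- x) = Qp_abs x.
Proof.
rewrite -(Qp_reprK x) -Qp_ofN; apply: Qp_absE => e e0.
have [N hN] := Qp_abs_lim (Qp_repr x) e0; exists N => n Nn.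
by rewrite padic_absN hN.
Qed.

Lemma Qp_absC x y : Qp_abs (x - y) = Qp_abs (y - x).
Proof. by rewrite -opprB Qp_absN. Qed.

Lemma Qp_abs_add x y : Qp_abs (x + y) <= Num.max (Qp_abs x) (Qp_abs y).
Proof.
apply/ler_addgt0Pl => e e0; set c := (X in _ <= _ + X).
rewrite -(Qp_reprK x) -(Qp_reprK y) -Qp_ofD.
have lt z : Qp_abs z <= c -> Qp_abs (Qp_of (Qp_repr z)) < e + c.
  by move=> zc; rewrite Qp_reprK (le_lt_trans zc) // ltrDr.
have [|N hN] := @Qp_abs_lt (Qp_repr x) (e + c).
  by apply: lt; rewrite le_max lexx.
have [|M hM] := @Qp_abs_lt (Qp_repr y) (e + c).
  by apply: lt; rewrite le_max lexx orbT.
apply: Qp_abs_le; exists (maxn N M) => n; rewrite geq_max => /andP[Nn Mn].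
apply: le_trans (padic_abs_add _ _ _) _.
by rewrite ge_max !ltW ?hN ?hM.
Qed.

Lemma Qp_absD x y : Qp_abs (x + y) <= Qp_abs x + Qp_abs y.
Proof.
apply: le_trans (Qp_abs_add x y) _.
by rewrite ge_max lerDl lerDr !Qp_abs_ge0.
Qed.

Definition Qp_dist x y : rat := Qp_abs (x - y).

Let Qp_distxx x : Qp_dist x x = 0.
Proof. by rewrite /Qp_dist subrr Qp_abs0. Qed.

Let Qp_dist_eq0 x y : Qp_dist x y = 0 -> x = y.
Proof. by move/eqP; rewrite Qp_abs_eq0 subr_eq0 => /eqP. Qed.

Let Qp_dist_triangle y x z : Qp_dist x z <= Qp_dist x y + Qp_dist y z.
Proof. by rewrite /Qp_dist -[x - z](subrKA y) Qp_absD. Qed.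

HB.instance Definition _ :=
  @isMetric.Build rat (Qp p) Qp_dist Qp_distxx Qp_dist_eq0 Qp_absC Qp_dist_triangle.

Lemma Qp_mdistE x y : mdist x y = Qp_abs (x - y). Proof. by []. Qed.

Lemma cst_cauchy (q : rat) : (fun=> q) \in cauchy_pred p.
Proof. exact/asboolP/padic_cauchy_cst. Qed.

Definition Qp_rat (q : rat) : Qp p := Qp_of (CauchySeq (cst_cauchy q)).

Let Qp_rat_zmod : zmod_morphism Qp_rat.
Proof. by move=> a b; rewrite /Qp_rat -Qp_ofB; congr Qp_of; exact: val_inj. Qed.

Let Qp_rat_monoid : monoid_morphism Qp_rat.
Proof.
split=> [|a b]; first by rewrite -Qp_of1; congr Qp_of; exact: val_inj.
by rewrite /Qp_rat -Qp_ofM; congr Qp_of; exact: val_inj.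
Qed.

HB.instance Definition _ := GRing.isZmodMorphism.Build rat (Qp p) Qp_rat Qp_rat_zmod.
HB.instance Definition _ := GRing.isMonoidMorphism.Build rat (Qp p) Qp_rat Qp_rat_monoid.

Lemma Qp_ratrE (q : rat) : ratr q = Qp_of (CauchySeq (cst_cauchy q)).
Proof. by rewrite -[RHS]/(Qp_rat q) (fmorph_eq_rat Qp_rat). Qed.

Lemma Qp_abs_ratr (q : rat) : Qp_abs (ratr q) = padic_abs p q.
Proof.
rewrite Qp_ratrE; apply: Qp_absE => e e0; exists 0%N => n _.
by rewrite subrr normr0.
Qed.

Lemma Qp_approx x e : 0 < e -> exists q : rat, Qp_abs (x - ratr q) < e.
Proof.
move=> e0; rewrite -(Qp_reprK x); set u := Qp_repr x.
have e2 : 0 < e / 2 by rewrite divr_gt0.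
have [N hN] := cauchy_seqP u e2; exists (u N).
apply: (@le_lt_trans _ _ (e / 2)); last by rewrite [ltRHS]splitr ltrDl.
rewrite Qp_ratrE -Qp_ofB; apply: Qp_abs_le; exists N => n Nn.
exact/ltW/hN.
Qed.

Lemma Qp_dense_rat : dense (range (ratr : rat -> Qp p)).
Proof.
move=> O [x Ox] oO.
have /nbhs_ballP[e /= e0 he] := open_nbhs_nbhs (conj oO Ox).
have [q hq] := Qp_approx x e0.
by exists (ratr q); split; [apply: he; rewrite ballEmdist|exists q].
Qed.

Lemma Qp_complete (X : nat -> Qp p) :
  (forall e, 0 < e -> exists N, forall m n, (N <= m)%N -> (N <= n)%N ->
    Qp_abs (X m - X n) < e) ->
  exists x, forall e, 0 < e -> exists N, forall n, (N <= n)%N -> Qp_abs (X n - x) < e.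
Proof.
move=> cX.
have /choice[q hq] n : exists q : rat, Qp_abs (X n - ratr q) < n.+1%:R^-1.
  by apply: Qp_approx; rewrite invr_gt0.
have arch e : 0 < e -> exists N, forall n, (N <= n)%N -> (n.+1%:R^-1 : rat) < e.
  move=> e0; exists (Num.bound e^-1) => n hn; rewrite invf_plt ?posrE ?ltr0n //.
  rewrite (lt_le_trans (archi_boundP _)) ?invr_ge0 ?(ltW e0) // ler_nat.
  exact: leq_trans hn _.
have hq' e : 0 < e -> exists N, forall n, (N <= n)%N -> Qp_abs (X n - ratr (q n)) < e.
  by move=> /arch[N hN]; exists N => n /hN; exact: lt_trans.
have cq : padic_cauchy p q.
  move=> e e0; have [N hN] := cX e e0; have [M hM] := hq' e e0.
  exists (maxn N M) => m n; rewrite !geq_max => /andP[Nm Mm] /andP[Nn Mn].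
  rewrite -Qp_abs_ratr !Qp_ratrE.
  have -> : Qp_of (CauchySeq (cst_cauchy (q m - q n))) = ratr (q m) - ratr (q n).
    by rewrite !Qp_ratrE; exact: Qp_rat_zmod.
  rewrite -[_ - _](subrKA (X m)) (le_lt_trans (Qp_abs_add _ _)) //.
  rewrite gt_max Qp_absC hM //= -[_ - _](subrKA (X n)).
  by rewrite (le_lt_trans (Qp_abs_add _ _)) // gt_max hN // hM.
have qc : q \in cauchy_pred p by exact/asboolP.
exists (Qp_of (CauchySeq qc)) => e e0.
have e2 : 0 < e / 2 by rewrite divr_gt0.
have [N hN] := cq _ e2; have [M hM] := hq' e e0.
exists (maxn N M) => n; rewrite !geq_max => /andP[Nn Mn].
rewrite -[_ - _](subrKA (ratr (q n))) (le_lt_trans (Qp_abs_add _ _)) //.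
rewrite gt_max hM //= Qp_ratrE -Qp_ofB.
apply: (@le_lt_trans _ _ (e / 2)); last by rewrite [ltRHS]splitr ltrDl.
by apply: Qp_abs_le; exists N => m Nm; exact/ltW/hN.
Qed.

End PadicNumbers.

Definition sum_squares (n : nat) : set nat :=
  [set a | (0 < a)%N /\ exists x : 'I_n -> nat, a = (\sum_(i < n) x i ^ 2)%N].

Definition ratio_set (S : set nat) : set rat :=
  [set q | exists a a', [/\ S a, S a' & q = a%:R / a'%:R]].

(* Main.v *)
(** If every element of [S] has even valuation, then so does every ratio, and no
    ratio is close to [p]; this settles [n = 1], and [n = 2] with [p = 3 %[mod 4]].
    For [p = 2] a positive sum of two squares is [2 ^ k * (4 * b + 1)], so no ratio
    is close to [3].

    Conversely, [S_n] is stable under multiplication by nonzero squares, so a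
    denominator can be cleared by its square, and it suffices to approximate
    positive integers [N], i.e. to solve [a = N * a' %[mod p ^ k]] in [S_n] with
    [a'] prime to [p].  For odd [p], Hensel lifting makes [-1] a sum of two squares
    modulo [p ^ k], and a single square if [p = 1 %[mod 4]]; then take [a' = 1] and
    substitute in [N = ((N + 1) / 2)^2 - ((N - 1) / 2)^2].  For [p = 2], integers
    congruent to [1] modulo [8] are squares modulo [2 ^ k], whence [a' = 1] works if
    [N] is [1, 2, 3, 5] or [6] modulo [8]; if [N = 7 %[mod 8]], then [a' = 3] works
    because [3 * N = 5 %[mod 8]]; and multiples of [4] are divided by [4]. *)

Require Import Defs.
From mathcomp Require Import all_boot all_order all_algebra all_field.
From mathcomp Require Import all_classical topology.
From mathcomp Require Import ring zify.

Set Implicit Arguments.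
Unset Strict Implicit.
Unset Printing Implicit Defensive.

Import Order.TTheory GRing.Theory Num.Theory.

Local Open Scope ring_scope.

(** * Sums of squares equal to -1 modulo a prime *)

Lemma dvdz_Fp (p : nat) (z : int) : prime p ->
  (p%:Z %| z)%Z = (z%:~R == 0 :> 'F_p).
Proof.
move=> pp; have cp := pchar_Fp pp.
rewrite dvdzE absz_nat (dvdn_pcharf cp); case: z => n //.
by rewrite NegzE abszN mulrNz oppr_eq0.
Qed.

Lemma Fp_intr (p : nat) (x : 'F_p) : exists z : int, x = z%:~R.
Proof. by exists (Posz x); rewrite -[LHS]natr_Zp. Qed.

Lemma Fp_expf_pred (p : nat) (x : 'F_p) : prime p -> x != 0 -> x ^+ p.-1 = 1.
Proof.
move=> pp x0; apply: (mulfI x0); rewrite -exprS prednK ?prime_gt0 // mulr1.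
by have := expf_card x; rewrite card_Fp.
Qed.

Lemma neg1_square_mod (p : nat) : prime p -> p = 1 %[mod 4] ->
  exists u : int, (p%:Z %| u ^+ 2 + 1)%Z.
Proof.
move=> pp p1; pose d := (p.-1 %/ 4)%N.
have pd : p.-1 = (d * 4)%N by rewrite /d; have := prime_gt1 pp; lia.
have d0 : (0 < d)%N by have := prime_gt1 pp; lia.
(* Otherwise all [p - 1] units would be roots of a polynomial of degree [(p - 1) / 2]. For such an
   [x], the power [x ^+ (d * 2)] is a square root of 1 other than 1, so it is -1, the square of
   [x ^+ d]. *)
have [x /andP[x0 nx]] : exists x : 'F_p, (x != 0) && (x ^+ (d * 2) != 1).
  apply/existsP; apply: contraT => /existsPn h.
  pose q : {poly 'F_p} := 'X^(d * 2) - 1%:P.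
  have sq : size q = (d * 2).+1 by rewrite size_XnsubC ?muln_gt0 ?d0.
  have q0 : q != 0 by rewrite -size_poly_gt0 sq.
  have := @max_poly_roots _ q (enum (predC1 (0 : 'F_p))) q0.
  rewrite enum_uniq -cardE cardC1 card_Fp // sq => /(_ _ isT) H.
  suff : (p.-1 < (d * 2).+1)%N by lia.
  apply: H; apply/allP => x; rewrite mem_enum inE => x0.
  move: (h x); rewrite x0 negbK /= => /eqP xd.
  by rewrite /root !hornerE xd subrr.
have : (x ^+ (d * 2)) ^+ 2 == 1.
  by rewrite -exprM -mulnA -pd Fp_expf_pred.
rewrite sqrf_eq1 (negbTE nx) /= => /eqP xm1.
have [u uE] := Fp_intr (x ^+ d); exists u.
by rewrite dvdz_Fp // rmorphD rmorphXn /= -uE -exprM xm1 addNr.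
Qed.

(** Pigeonhole: the [(p + 1) / 2] squares of ['F_p] and their images under [x |-> - (x + 1)] cannot
    be disjoint. One of the two terms must be a unit so that it can be lifted later. *)
Lemma neg1_two_squares_mod (p : nat) : prime p -> odd p ->
  exists u v : int, ~~ (p%:Z %| u)%Z /\ (p%:Z %| u ^+ 2 + v ^+ 2 + 1)%Z.
Proof.
move=> pp op; pose h := (p.+1./2)%N.
have hp : (h.*2 = p.+1)%N by rewrite /h even_halfK //= op.
have F0 (n : nat) : (n < p)%N -> (n%:R == 0 :> 'F_p) = (n == 0%N).
  move=> np; rewrite -(dvdn_pcharf (pchar_Fp pp)).
  by case: n np => [|n] np; rewrite ?dvdn0 // gtnNdvd.
have inj : injective (fun i : 'I_h => (i%:R : 'F_p) ^+ 2).
  move=> i j /eqP; rewrite eqf_sqr => /orP[]; last first.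
    rewrite -subr_eq0 opprK -natrD F0; last by have := ltn_ord i; have := ltn_ord j; lia.
    by move=> ij; apply: val_inj => /=; lia.
  move=> ij; apply: val_inj => /=.
  wlog ltij : i j ij / (j <= i)%N.
    move=> H; case: (leqP j i) => [|/ltnW] ji; first exact: H.
    by apply/esym/H; rewrite // eq_sym.
  move: ij; rewrite -subr_eq0 -natrB // F0; have := ltn_ord i; lia.
pose A := [set (i%:R : 'F_p) ^+ 2 | i : 'I_h].
pose B := [set - (x + 1) | x in A].
have cA : #|A| = h by rewrite card_imset // card_ord.
have cB : #|B| = h by rewrite card_imset // => x y /oppr_inj /addIr.
have /set0Pn[z] : A :&: B != finset.set0.
  apply/eqP => AB0; have := cardsUI A B; rewrite AB0 cards0 cA cB.
  by have := max_card (A :|: B); rewrite card_Fp //; lia.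
rewrite inE => /andP[/imsetP[i _ ->] /imsetP[_ /imsetP[j _ ->]]] E.
have sum0 : (p%:Z %| (i : nat)%:Z ^+ 2 + (j : nat)%:Z ^+ 2 + 1)%Z.
  rewrite dvdz_Fp // !rmorphD !rmorphXn /= -!pmulrn E.
  by apply/eqP; ring.
have [pi|pi] := boolP (p%:Z %| (i : nat)%:Z)%Z; last by exists i, j.
exists (j : nat)%:Z, (i : nat)%:Z; split; last by rewrite [X in X + 1]addrC.
apply/negP => pj; move: sum0; rewrite !rpredDl ?expr2 ?dvdz_mull //.
rewrite dvdzE /= dvdn1; have := prime_gt1 pp; lia.
Qed.

(** * Hensel lifting of square roots, for odd [p] and for 2 *)

Lemma hensel_square (p : nat) (c u : int) (k : nat) : prime p -> odd p ->
  ~~ (p%:Z %| u)%Z -> (p%:Z %| u ^+ 2 - c)%Z ->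
  exists x : int, (p%:Z ^+ k %| x ^+ 2 - c)%Z.
Proof.
move=> pp op pu puc.
suff [x [_ H]] : exists x : int, ~~ (p%:Z %| x)%Z /\ (p%:Z ^+ k.+1 %| x ^+ 2 - c)%Z.
  by exists x; apply: dvdz_trans H; rewrite exprS dvdz_mull.
elim: k => [|k [x [px /dvdzP[t E]]]]; first by exists u.
have cop : coprimez (2 * x) p%:Z.
  rewrite coprimezMl; apply/andP; split.
    by rewrite coprimezE /= prime_coprime // dvdn_prime2 //; lia.
  by rewrite coprimez_sym coprimezE prime_coprime // -dvdzE.
have [[a b] /= ab] := coprimezP _ _ cop.
(* Newton step: [a] inverts the derivative [2 * x] modulo [p]. *)
exists (x - a * t * p%:Z ^+ k.+1); split.
  by rewrite rpredBr ?exprS 1?mulrCA ?dvdz_mulr.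
apply/dvdzP; exists (b * t + a ^+ 2 * t ^+ 2 * p%:Z ^+ k).
have -> : (x - a * t * p%:Z ^+ k.+1) ^+ 2 - c =
  (x ^+ 2 - c) - 2 * x * a * t * p%:Z ^+ k.+1 + (a * t * p%:Z ^+ k.+1) ^+ 2 by ring.
have -> : 2 * x * a = 1 - b * p%:Z by move: ab => /=; lia.
rewrite E !exprS; ring.
Qed.

Lemma hensel_square2 (c : int) (k : nat) : (8 %| c - 1)%Z ->
  exists x : int, (2 ^+ k %| x ^+ 2 - c)%Z.
Proof.
move=> c1.
suff [x [_ H]] : exists x : int, ~~ (2 %| x)%Z /\ (2 ^+ k.+3 %| x ^+ 2 - c)%Z.
  by exists x; apply: dvdz_trans H; rewrite !exprS !mulrA dvdz_mull.
elim: k => [|k [x [px /dvdzP[t E]]]].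
  by exists 1; split => //; rewrite expr1n -opprB rpredN.
(* The derivative [2 * x] is even, so the correction is one power of 2 lower than the error: it adds
   [x * t * 2 ^+ k.+3], and [t + x * t] is even because [x] is odd. *)
exists (x + t * 2 ^+ k.+2); split.
  by rewrite rpredDr ?exprS 1?mulrCA ?dvdz_mulr.
have [y xE] : exists y : int, x = 2 * y + 1.
  by exists (x %/ 2)%Z; lia.
apply/dvdzP; exists (t * (y + 1) + t ^+ 2 * 2 ^+ k).
have -> : (x + t * 2 ^+ k.+2) ^+ 2 - c =
  (x ^+ 2 - c) + 2 * x * t * 2 ^+ k.+2 + (t * 2 ^+ k.+2) ^+ 2 by ring.
rewrite E xE !exprS; ring.
Qed.

(** * Representing integers by squares modulo prime powers *)

Lemma neg1_squares_residues (m N : int) (r : seq int) : ~~ (2 %| m)%Z ->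
  (m %| \sum_(y <- r) y ^+ 2 + 1)%Z ->
  exists x t : int, (m %| x ^+ 2 + \sum_(y <- [seq t * y | y <- r]) y ^+ 2 - N)%Z.
Proof.
move=> m2 /dvdzP[s E]; have [h hE] : exists h : int, 2 * h = m + 1.
  by exists ((m + 1) %/ 2)%Z; lia.
(* Here [h] is the inverse of 2 modulo [m]. *)
exists (h * (N + 1)), (h * (N - 1)).
rewrite big_map; under eq_bigr do rewrite exprMn; rewrite -mulr_sumr.
apply/dvdzP; exists ((h * (N - 1)) ^+ 2 * s + (m + 2) * N).
have -> : (h * (N + 1)) ^+ 2 + (h * (N - 1)) ^+ 2 * \sum_(y <- r) y ^+ 2 - N
  = (h * (N - 1)) ^+ 2 * (\sum_(y <- r) y ^+ 2 + 1) + ((2 * h) ^+ 2 - 1) * N by ring.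
by rewrite E hE; ring.
Qed.

Lemma three_squares_mod2X (k N : nat) : (0 < N)%N -> exists b x y z : int,
  (b = 1 \/ b = 3) /\ (2 ^+ k %| x ^+ 2 + y ^+ 2 + z ^+ 2 - N%:Z * b)%Z.
Proof.
elim/ltn_ind: N => N IH N0.
have base (b y z : int) : b = 1 \/ b = 3 -> (8 %| (N%:Z * b - y ^+ 2 - z ^+ 2) - 1)%Z ->
    exists b x y z : int,
    (b = 1 \/ b = 3) /\ (2 ^+ k %| x ^+ 2 + y ^+ 2 + z ^+ 2 - N%:Z * b)%Z.
  move=> hb /(hensel_square2 k)[x hx]; exists b, x, y, z; split => //.
  by apply: etrans hx; congr (_ %| _)%Z; ring.
have [N4|N4] := boolP (4 %| N)%N.
  have [||b [x [y [z [hb]]]]] := IH (N %/ 4)%N; [lia|lia|].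
  move=> hx; exists b, (2 * x), (2 * y), (2 * z); split => //.
  have NE : N%:Z = 4 * (N %/ 4)%N%:Z by lia.
  rewrite [X in (_ %| X)%Z](_ : _ = 4 * (x ^+ 2 + y ^+ 2 + z ^+ 2 - (N %/ 4)%N%:Z * b)).
    by rewrite dvdz_mull.
  by rewrite [in LHS]NE; ring.
have : (N %% 8 = 1 \/ N %% 8 = 2 \/ N %% 8 = 3 \/
          N %% 8 = 5 \/ N %% 8 = 6 \/ N %% 8 = 7)%N by lia.
(* In each class [y] and [z] make [N * b - y ^ 2 - z ^ 2] congruent to 1 modulo 8, hence a square
   modulo [2 ^ k]. *)
by case=> [h|[h|[h|[h|[h|h]]]]];
  [apply: (base 1 0 0)|apply: (base 1 1 0)|apply: (base 1 1 1)
  |apply: (base 1 2 0)|apply: (base 1 2 1)|apply: (base 3 2 0)]; lia.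
Qed.

(** * Valuations and 2-adic shape of sums of two squares *)

Lemma logn_sum2squares_even (p x y : nat) : prime p -> p = 3 %[mod 4] ->
  (0 < x ^ 2 + y ^ 2)%N -> ~~ odd (logn p (x ^ 2 + y ^ 2)).
Proof.
move=> pp p3.
(* If [a] were a unit, raising [a ^ 2 = - b ^ 2] to the odd power [(p - 1) / 2] would give 1 =
   -1. *)
have key a b : (p %| a ^ 2 + b ^ 2)%N -> (p %| a)%N.
  rewrite !(dvdn_pcharf (pchar_Fp pp)) natrD !natrX addr_eq0 => /eqP E.
  apply/negPn/negP => a0; have b0 : (b%:R : 'F_p) != 0.
    by apply: contraNneq a0 => b0; move: E; rewrite b0 expr0n oppr0 => /eqP; rewrite sqrf_eq0.
  have := congr1 (fun z => z ^+ (p.-1)./2) E.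
  have pE : p.-1 = (2 * (p.-1)./2)%N by lia.
  rewrite exprNn -!exprM -pE !Fp_expf_pred // mulr1 -signr_odd.
  have -> : odd (p.-1)./2 by lia.
  rewrite expr1 => /eqP; rewrite -subr_eq0 opprK -(natrD _ 1 1).
  rewrite -(dvdn_pcharf (pchar_Fp pp)) => /dvdn_leq -/(_ isT); lia.
elim: {x}x.+1 {-2}x y (ltnSn x) => // n IH x y xn s0.
have [ps|ps] := boolP (p %| x ^ 2 + y ^ 2)%N; last by rewrite lognE (negPf ps) !andbF.
have /dvdnP[a xE] := key _ _ ps.
have /dvdnP[b yE] : (p %| y)%N by apply: (key y x); rewrite addnC.
have p1 := prime_gt1 pp.
have E : (x ^ 2 + y ^ 2 = p ^ 2 * (a ^ 2 + b ^ 2))%N by rewrite xE yE; lia.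
have ab0 : (0 < a ^ 2 + b ^ 2)%N by move: s0; rewrite E muln_gt0 => /andP[].
rewrite E lognM ?expn_gt0 ?(prime_gt0 pp) // pfactorK // oddD /=.
(* Descent on [x]: [a < x] holds only if [a] is positive; for [a = 0] the remaining factor is the
   square [b ^ 2]. *)
have [a0|a0] := posnP a; last first.
  by apply: IH => //; rewrite -ltnS (leq_trans _ xn) // ltnS xE ltn_Pmulr.
move: ab0; rewrite a0 add0n expn_gt0 orbF => b0.
by rewrite lognX oddM.
Qed.

Lemma sum2squares_2part (x y : nat) : (0 < x ^ 2 + y ^ 2)%N ->
  exists k b, (x ^ 2 + y ^ 2 = 2 ^ k * (4 * b + 1))%N.
Proof.
move: {2}(x + y).+1%N (ltnSn (x + y)) => n.
elim: n x y => // n IH x y xyn; rewrite addn_gt0 !expn_gt0 !orbF => s0.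
have half z : z = (odd z + 2 * z./2)%N by lia.
case ox : (odd x); case oy : (odd y); rewrite (half x) (half y) ox oy.
- set a := x./2; set b := y./2.
  (* For [x] and [y] odd the sum is [2 * (2 * (a * a.+1 + b * b.+1) + 1)]. *)
  have /dvdnP[c cE] : (2 %| a * a.+1 + b * b.+1)%N.
    by rewrite dvdn2 oddD !oddM /=; case: (odd a); case: (odd b).
  by exists 1%N, c; lia.
- by exists 0%N, (x./2 ^ 2 + x./2 + y./2 ^ 2)%N; lia.
- by exists 0%N, (x./2 ^ 2 + y./2 + y./2 ^ 2)%N; lia.
- have [||k [b E]] := IH x./2 y./2; [by lia|by rewrite addn_gt0 !expn_gt0 !orbF; lia|].
  by exists k.+2, b; rewrite !expnS -!mulnA -E; lia.
Qed.

(** * Density in [Qp p] through approximation of rationals *)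

Local Open Scope classical_set_scope.
Local Open Scope ring_scope.

(** Since the rationals are dense in [Qp p], the rest of the proof can work with [padic_abs] on
    [rat] alone. *)
Lemma dense_ratrP (p : nat) (A : set rat) :
  dense ((ratr : rat -> Qp p) @` A) <->
  forall q e : rat, 0 < e -> exists2 r, A r & padic_abs p (q - r) < e.
Proof.
have ratrB q r : ratr q - ratr r = ratr (q - r) :> Qp p.
  by rewrite -!(fmorph_eq_rat (@Qp_rat p)) rmorphB.
split=> [dA q e e0|dA O [x Ox] oO].
  have [|y [By [r Ar yE]]] := dA _ _ (open_interior (ball (ratr q : Qp p) e)).
    by exists (ratr q); exact: nbhsx_ballx.
  exists r => //; have := interior_subset By.
  by rewrite -yE ballEmdist /= Qp_mdistE ratrB Qp_abs_ratr.
have /nbhs_ballP[e /= e0 he] := open_nbhs_nbhs (conj oO Ox).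
have [q hq] := Qp_approx x e0.
have [r Ar hr] := dA q e e0.
exists (ratr r); split; last by exists r.
apply: he; rewrite ballEmdist /= Qp_mdistE -[_ - _](subrKA (ratr q)).
by rewrite (le_lt_trans (Qp_abs_add _ _)) // gt_max hq ratrB Qp_abs_ratr.
Qed.

Lemma padic_abs_int (p : nat) (z : int) : z != 0 ->
  padic_abs p z%:~R = p%:R ^- logn p `|z|.
Proof.
move=> z0; rewrite /padic_abs intr_eq0 (negbTE z0) /padic_val numq_int denq_int.
by rewrite logn1 subr0 -exprnN.
Qed.

Lemma padic_abs_dvd (p k : nat) (z : int) : prime p -> (p%:Z ^+ k %| z)%Z ->
  padic_abs p z%:~R <= p%:R ^- k.
Proof.
move=> pp; have p0 : 0 < (p%:R : rat) by rewrite ltr0n prime_gt0.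
have [->|z0] := eqVneq z 0; first by rewrite padic_abs0 invr_ge0 exprn_ge0 ?ltW.
rewrite dvdzE abszX absz_nat pfactor_dvdn ?absz_gt0 // => kz.
rewrite padic_abs_int // lef_pV2 ?posrE ?exprn_gt0 //.
by rewrite ler_weXn2l // ler1n prime_gt0.
Qed.

Lemma padic_abs_unit (p : nat) (z : int) : ~~ (p%:Z %| z)%Z ->
  padic_abs p z%:~R = 1.
Proof.
move=> pz; rewrite padic_abs_int; last by apply: contraNneq pz => ->; rewrite dvdz0.
by rewrite lognE -[(p %| `|z|)%N]/(p%:Z %| z)%Z (negbTE pz) !andbF invr1.
Qed.

Lemma padic_expVn_small (p : nat) (e : rat) : prime p -> 0 < e ->
  exists k, p%:R ^- k < e.
Proof.
move=> pp e0; exists (Num.bound e^-1).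
rewrite invf_plt ?posrE ?exprn_gt0 ?ltr0n ?prime_gt0 //.
rewrite (lt_trans (archi_boundP _)) ?invr_ge0 ?(ltW e0) //.
by rewrite -natrX ltr_nat ltn_expl // prime_gt1.
Qed.

Lemma not_dense_even_logn (p : nat) (S : set nat) : prime p ->
  (forall a, S a -> (0 < a)%N /\ ~~ odd (logn p a)) ->
  ~ dense ((ratr : rat -> Qp p) @` ratio_set S).
Proof.
move=> pp evS /dense_ratrP dS; have p1 := prime_gt1 pp.
have p0 : (p%:R : rat) != 0 by rewrite pnatr_eq0; lia.
(* A ratio closer to [p] than the absolute value of [p] has the same absolute value, so its
   valuation would be 1, which is odd. *)
have [|_ [a [a' [/evS[a0 ea] /evS[a'0 ea'] ->]]]] := dS p%:R (padic_abs p p%:R).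
  by rewrite padic_abs_gt0.
have r0 : a%:R / a'%:R != 0 :> rat.
  by rewrite mulf_neq0 ?invr_eq0 // pnatr_eq0 -lt0n.
move=> /padic_abs_isosceles; rewrite /padic_abs (negbTE p0) (negbTE r0).
have -> : padic_val p (a%:R / a'%:R) = (logn p a)%:Z - (logn p a')%:Z.
  by rewrite (@padic_val_div p a%:Z a'%:Z) // eqz_nat -lt0n.
have -> : padic_val p p%:R = 1.
  rewrite -[p%:R]divr1 (@padic_val_div p p%:Z 1) ?logn1 ?subr0; last by [].
    by rewrite absz_nat -{2}[p]expn1 pfactorK.
  by lia.
have inj : injective (exprz (p%:R : rat)).
  by apply: ieexprIz; [rewrite ltr0n ltnW|rewrite pnatr_eq1 gtn_eqF].
by move=> /inj; lia.
Qed.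

Lemma dense_ratio_set (p : nat) (S : set nat) : prime p ->
  (forall a c : nat, S a -> (0 < c)%N -> S (a * c ^ 2)%N) ->
  (forall k N : nat, (0 < N)%N -> exists a a', [/\ S a, S a', ~~ (p %| a')%N &
     (p%:Z ^+ k %| a%:Z - N%:Z * a'%:Z)%Z]) ->
  dense ((ratr : rat -> Qp p) @` ratio_set S).
Proof.
move=> pp Ssq Sres; apply/dense_ratrP => q e e0.
pose d := `|denq q|%N.
have d0 : (0 < d)%N by rewrite absz_gt0 denq_eq0.
have dE : d%:Z = denq q by rewrite /d gez0_abs ?denq_ge0.
have dq0 : (d%:R : rat) != 0 by rewrite pnatr_eq0 -lt0n.
have [z qE] : exists z : int, q = z%:~R / d%:R ^+ 2.
  exists (numq q * denq q); rewrite rmorphM /= -dE -[in LHS](divq_num_den q) -dE -pmulrn.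
  by field.
(* The precision allows for the later division by [d ^ 2]. *)
have [k ke] := padic_expVn_small pp (mulr_gt0 e0 (padic_abs_gt0 p (expf_neq0 2 dq0))).
have pk0 : 0 < p%:Z ^+ k by rewrite exprn_gt0 // ltz_nat prime_gt0.
have [N [N0 /dvdzP[s Ns]]] : exists N : nat, (0 < N)%N /\ (p%:Z ^+ k %| N%:Z - z)%Z.
  (* Adding the modulus to the remainder makes the representative positive. *)
  exists `|((z %% p%:Z ^+ k)%Z + p%:Z ^+ k)%R|%N.
  have m0 := modz_ge0 z (lt0r_neq0 pk0).
  split; first by lia.
  rewrite gez0_abs; last by lia.
  apply/dvdzP; exists (1 - (z %/ p%:Z ^+ k)%Z).
  by rewrite [in X in _ - X](divz_eq z (p%:Z ^+ k)); ring.
have [a [a' [Sa Sa' pa' /dvdzP[t at']]]] := Sres k N N0.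
have a'0 : (a'%:R : rat) != 0.
  by rewrite pnatr_eq0; apply: contraNneq pa' => ->; rewrite dvdn0.
exists (a%:R / (a' * d ^ 2)%N%:R); first by exists a, (a' * d ^ 2)%N; split=> //; exact: Ssq.
have -> : q - a%:R / (a' * d ^ 2)%N%:R =
    (z * a'%:Z - a%:Z)%:~R / (a'%:Z%:~R * d%:R ^+ 2).
  rewrite qE natrM natrX rmorphB rmorphM /= -!pmulrn.
  by field; rewrite a'0 dq0.
rewrite padic_absM padic_absV padic_absM (@padic_abs_unit p a'%:Z pa') mul1r.
rewrite ltr_pdivrMr ?padic_abs_gt0 ?expf_neq0 //.
apply: le_lt_trans ke; apply: padic_abs_dvd => //.
apply/dvdzP; exists (- t - s * a'%:Z).
have -> : z = N%:Z - s * p%:Z ^+ k by rewrite -Ns; ring.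
have -> : a%:Z = N%:Z * a'%:Z + t * p%:Z ^+ k by rewrite -at'; ring.
ring.
Qed.

(** * The sets of sums of squares and their ratios *)

Lemma sum_squares_mul_sqr (n a c : nat) :
  sum_squares n a -> (0 < c)%N -> sum_squares n (a * c ^ 2)%N.
Proof.
move=> [a0 [x aE]] c0; split; first by rewrite muln_gt0 a0 expn_gt0 c0.
exists (fun i => x i * c)%N; rewrite aE big_distrl /=.
by apply: eq_bigr => i _; rewrite expnMn.
Qed.

Lemma sum_squares_seq (n : nat) (s : seq nat) : (size s <= n)%N ->
  (0 < \sum_(x <- s) x ^ 2)%N -> sum_squares n (\sum_(x <- s) x ^ 2)%N.
Proof.
move=> sn s0; split => //; exists (fun i : 'I_n => nth 0%N s i).
rewrite (big_nth 0%N) big_mkord.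
rewrite (big_ord_widen n (fun i => nth 0%N s i ^ 2)%N sn) big_mkcond /=.
by apply: eq_bigr => i _; case: ltnP => // si; rewrite nth_default.
Qed.

Lemma sum_squares_mod (m : int) (n : nat) (x : int) (s : seq int) : 0 < m ->
  (size s < n)%N -> exists a, sum_squares n a /\
  (m %| a%:Z - (x ^+ 2 + \sum_(y <- s) y ^+ 2))%Z.
Proof.
(* Positive representatives keep the sum of squares nonzero. *)
move=> m0 sn; pose f (y : int) := `|((y %% m)%Z + m)%R|%N.
have f0 y : (0 < f y)%N by have := modz_ge0 y (lt0r_neq0 m0); rewrite /f; lia.
exists (\sum_(y <- [seq f y | y <- x :: s]) y ^ 2)%N; split.
  apply: sum_squares_seq; first by rewrite size_map.
  by rewrite big_cons addn_gt0 expn_gt0 f0.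
have fE y : exists c, (f y)%:Z = y + c * m.
  exists (1 - (y %/ m)%Z).
  rewrite gez0_abs; last by have := modz_ge0 y (lt0r_neq0 m0); lia.
  by rewrite [X in _ = X + _](divz_eq y m); ring.
rewrite -(big_cons 0 +%R x s xpredT (fun y => y ^+ 2)).
elim: (x :: s) => [|y r IH]; first by rewrite /= !big_nil subrr dvdz0.
rewrite /= !big_cons PoszD opprD addrACA rpredD // -mulnn PoszM.
have [c ->] := fE y; apply/dvdzP; exists (2 * y * c + c ^+ 2 * m); ring.
Qed.

Lemma sum_squares1_even_logn (p a : nat) : sum_squares 1 a ->
  (0 < a)%N /\ ~~ odd (logn p a).
Proof.
by move=> [a0 [x aE]]; split=> //; rewrite aE big_ord1 lognX oddM.
Qed.

Lemma sum_squares2_not_dense2 :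
  ~ dense ((ratr : rat -> Qp 2) @` ratio_set (sum_squares 2)).
Proof.
have part a : sum_squares 2 a -> exists k b, a = (2 ^ k * (4 * b + 1))%N.
  case=> a0 [x aE]; move: a0; rewrite aE !big_ord_recl big_ord0 addn0.
  exact: sum2squares_2part.
move=> /dense_ratrP /(_ 3 (2%:R ^- 1)) [//|_ [_ [_ [/part[k [b ->]] /part[l [c ->]] ->]]]].
set B := (4 * b + 1)%N; set C := (4 * c + 1)%N.
have odd_abs (n : nat) : odd n -> padic_abs 2 n%:R = 1.
  by move=> on; apply: (@padic_abs_unit 2 n%:Z); lia.
have abs2 : padic_abs 2 2%:R = 2%:R^-1 by exact: (@padic_abs_int 2 2).
have absX n : padic_abs 2 (2 ^ n)%:R = 2%:R ^- n.
  elim: n => [|n IH]; first by rewrite padic_abs1 invr1.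
  by rewrite expnS natrM padic_absM IH abs2 exprS invfM.
have oB : odd B by rewrite /B; lia.
have oC : odd C by rewrite /C; lia.
have C0 : (C%:R : rat) != 0 by rewrite pnatr_eq0 /C; lia.
have p0 n : (2 ^ n)%:R != 0 :> rat by rewrite pnatr_eq0 expn_eq0.
(* The ratio lies within 1/2 of the unit 3, so it is a unit as well and the powers of 2 cancel. *)
move=> h; have kl : k = l.
  have : padic_abs 2 ((2 ^ k * B)%:R / (2 ^ l * C)%:R) = padic_abs 2 3.
    apply: padic_abs_isosceles; apply: lt_trans h _.
    by rewrite (odd_abs 3).
  rewrite (odd_abs 3) // padic_absM padic_absV !natrM !padic_absM.
  rewrite (odd_abs B) // (odd_abs C) // !absX !mulr1 invrK => E.
  have := mulVKf (p0 k) (2%:R ^+ l); rewrite natrX E mulr1 => /eqP.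
  by rewrite -!natrX eqr_nat eqn_exp2l // => /eqP.
move: h; rewrite kl !natrM.
(* The difference is twice a 2-adic unit: its absolute value is exactly 1/2, contradicting the
   strict bound. *)
have -> : 3 - (2 ^ l)%:R * B%:R / ((2 ^ l)%:R * C%:R) =
    2 * (1 + 2 * (3 * c%:R - b%:R)) / C%:R :> rat.
  have E : (C%:R : rat) = 4 * c%:R + 1 by rewrite /C natrD natrM.
  have -> : (B%:R : rat) = 4 * b%:R + 1 by rewrite /B natrD natrM.
  by rewrite E in C0 *; field; rewrite C0 p0.
rewrite !padic_absM padic_absV (odd_abs C) // abs2 divr1.
have -> : 1 + 2 * (3 * c%:R - b%:R) = (1 + 2 * (3 * c%:Z - b%:Z))%:~R :> rat.
  by rewrite !(rmorphD, rmorphM, rmorphN).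
by rewrite padic_abs_unit ?mulr1 ?ltxx //; lia.
Qed.

Lemma sum_squares_dense_odd (p n : nat) : prime p -> odd p -> (0 < n)%N ->
  (forall k, exists2 r : seq int, (size r < n)%N &
     (p%:Z ^+ k %| \sum_(y <- r) y ^+ 2 + 1)%Z) ->
  dense ((ratr : rat -> Qp p) @` ratio_set (sum_squares n)).
Proof.
move=> pp op n0 hr.
apply: dense_ratio_set => // [a c|k N N0]; first exact: sum_squares_mul_sqr.
have [r rn hk] := hr k.
have pk2 : ~~ (2 %| p%:Z ^+ k)%Z by rewrite dvdzE abszX absz_nat dvdn2 negbK oddX op orbT.
have [x [t xt]] := neg1_squares_residues N pk2 hk.
have [||a [Sa ma]] := @sum_squares_mod (p%:Z ^+ k) n x [seq t * y | y <- r].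
- by rewrite exprn_gt0 // ltz_nat prime_gt0.
- by rewrite size_map.
exists a, 1%N; split => //.
- have := @sum_squares_seq n [:: 1%N] n0; rewrite big_seq1; exact.
- by rewrite dvdn1; have := prime_gt1 pp; lia.
- by have := rpredD ma xt; rewrite addrA subrK mulr1.
Qed.

Lemma sum_squares2_dense (p : nat) : prime p -> p = 1 %[mod 4] ->
  dense ((ratr : rat -> Qp p) @` ratio_set (sum_squares 2)).
Proof.
move=> pp p1; have op : odd p by lia.
apply: sum_squares_dense_odd => // k; have [u pu] := neg1_square_mod pp p1.
have [||x hx] := @hensel_square p (- 1) u k pp op; last 1 first.
- by exists [:: x] => //; rewrite big_seq1 -[1]opprK.
(* If [p] divided [u], it would divide 1. *)
- apply/negP => /(dvdz_mulr u) pu2; move: pu; rewrite expr2 rpredDl // dvdzE /= dvdn1.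
  by have := prime_gt1 pp; lia.
- by rewrite opprK.
Qed.

Lemma sum_squares_dense_ge3 (n p : nat) : (3 <= n)%N -> prime p ->
  dense ((ratr : rat -> Qp p) @` ratio_set (sum_squares n)).
Proof.
move=> n3 pp; have [p2|op] := even_prime pp; last first.
  apply: sum_squares_dense_odd => // [|k]; first by lia.
  have [u [v [pu puv]]] := neg1_two_squares_mod pp op.
  (* Only the unit [u] is lifted; [v] stays fixed. *)
  have [|x hx] := @hensel_square p (- (v ^+ 2 + 1)) u k pp op pu _.
    by rewrite opprK addrA.
  by exists [:: x; v] => //; move: hx; rewrite !big_cons big_nil opprK addr0 addrA.
subst p; apply: dense_ratio_set => // [a c|k N N0]; first exact: sum_squares_mul_sqr.
have [b [x [y [z [hb hx]]]]] := three_squares_mod2X k N0.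
have [||a [Sa ma]] := @sum_squares_mod (2 ^+ k) n x [:: y; z]; rewrite ?exprn_gt0 //.
(* The denominator 1 or 3 is odd and is a sum of one or three unit squares. *)
exists a, `|b|%N; split => //.
- case: hb => ->.
    by have := @sum_squares_seq n [:: 1%N]; rewrite big_seq1; apply => //; exact: ltnW (ltnW n3).
  by have := @sum_squares_seq n [:: 1; 1; 1]%N; rewrite !big_cons big_nil; apply.
- by case: hb => ->.
- have -> : `|b|%N%:Z = b by case: hb => ->.
  have := rpredD ma hx; rewrite !big_cons big_nil.
  by rewrite [X in X \in _](_ : _ = a%:Z - N%:Z * b) //; ring.
Qed.

Theorem theorem4p1 :
  (forall p : nat, prime p ->
     ~ dense ((ratr : rat -> Qp p) @` ratio_set (sum_squares 1)))
  /\ (forall p : nat, prime p ->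
     dense ((ratr : rat -> Qp p) @` ratio_set (sum_squares 2)) <->
     p = 1 %[mod 4])
  /\ (forall n : nat, (3 <= n)%N -> forall p : nat, prime p ->
     dense ((ratr : rat -> Qp p) @` ratio_set (sum_squares n))).
Proof.
split=> [p pp|]; first by apply: not_dense_even_logn => // a; exact: sum_squares1_even_logn.
split=> [p pp|n n3 p pp]; last exact: sum_squares_dense_ge3.
split; last exact: sum_squares2_dense.
have [-> /sum_squares2_not_dense2//|op dS] := even_prime pp.
have [//|p3] : p = 1 %[mod 4] \/ p = 3 %[mod 4] by lia.
exfalso; apply: not_dense_even_logn dS => // a [a0 [x aE]]; split => //.
by move: a0; rewrite aE !big_ord_recl big_ord0 addn0; exact: logn_sum2squares_even.
Qed.
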